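(* Let $\mathbb{X}$ be a metric space, let $k>0$, and let $\mathcal{F}$ be a class of (closed) $k$-Ahlfors-David regular subsets of $\mathbb{X}$. Let $E\subseteq\mathbb{X}$ be a $k$-Ahlfors-David regular set with $E\in \mathrm{BP}(\mathrm{BP}(\mathcal{F}))$, say $E\in \mathrm{BP}_{\theta_1,C_1}(\mathrm{BP}_{\theta_2,C_2}(\mathcal{F}))$ with $\theta_1,\theta_2>0$ and $C_1,C_2>1$. Then there exists a set $F\subseteq\mathbb{X}$ such that (i) $E\subseteq F$; (ii) $F$ is $k$-Ahlfors-David regular; (iii) $F\in\mathrm{BP}(\mathcal{F})$. Moreover this is quantitative: there are constants $\theta'>0$ and $C'>1$ depending only on $k,\theta_1,C_1,\theta_2,C_2$ such that $F$ can be taken to be $k$-Ahlfors-David regular with constant $C'$ and to belong to $\mathrm{BP}_{\theta',C'}(\mathcal{F})$.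
   Context: $\mathcal{H}^k$ denotes $k$-dimensional Hausdorff measure on $\mathbb{X}$, and $B(x,r)$ denotes the ball of center $x$ and radius $r$ in $\mathbb{X}$. A closed set $E\subseteq\mathbb{X}$ with more than one point is $k$-Ahlfors-David regular with constant $C>1$ if for all $x\in E$ and all $r\in(0,\operatorname{diam}(E))$ (where $\operatorname{diam}(E)$ may be $\infty$) one has $C^{-1}r^k<\mathcal{H}^k(E\cap B(x,r))<Cr^k$. It is $k$-Ahlfors-David regular if this holds for some $C>1$. For a class $\mathcal{G}$ of $k$-Ahlfors-David regular subsets of $\mathbb{X}$ and constants $\theta>0$, $C>1$, $\mathrm{BP}_{\theta,C}(\mathcal{G})$ (''big pieces of $\mathcal{G}$'') is the class of all sets $F\subseteq\mathbb{X}$ that are $k$-Ahlfors-David regular with constant $C$ and such that for every $x\in F$ and every $R>0$ there is a set $G_{x,R}\in\mathcal{G}$ with $$\mathcal{H}^k(B(x,R)\cap F\cap G_{x,R})\ge\theta\,\mathcal{H}^k(B(x,R)\cap F).$$ One writes $F\in\mathrm{BP}(\mathcal{G})$ if $F\in\mathrm{BP}_{\theta,C}(\mathcal{G})$ for some $\theta>0$, $C>1$. In the iterated class the constants at each level are uniform: $E\in\mathrm{BP}(\mathrm{BP}(\mathcal{F}))$ means that $E\in\mathrm{BP}_{\theta_1,C_1}(\mathrm{BP}_{\theta_2,C_2}(\mathcal{F}))$ for some $\theta_1,\theta_2>0$ and $C_1,C_2>1$.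
   Formalization: Ahlfors-David regularity is taken for closed balls with 0 < r ≤ diam(E), endpoint included, instead of r in (0, diam(E)); with the endpoint left out, the claim fails in general metric spaces, since the mass of a bounded E is not controlled by its diameter. *)

(* Defs.v *)
From HB Require Import structures.
From mathcomp Require Import all_boot all_order all_algebra.
From mathcomp Require Import all_classical all_reals all_analysis.

Set Implicit Arguments.
Unset Strict Implicit.
Unset Printing Implicit Defensive.

Import Order.TTheory GRing.Theory Num.Theory.
Import numFieldNormedType.Exports.

Local Open Scope classical_set_scope.
Local Open Scope ring_scope.

Section Hausdorff.
Context {R : realType} {X : metricType R}.
Implicit Types (A E F : set X) (k C theta : R) (GG : set (set X)).

(* The maximum with 0 only matters for the empty set, whose supremum is -oo. *)
Definition diam A : \bar R :=
  maxe 0%E (ereal_sup [set (mdist x y)%:E | x in A & y in A]).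

(* Finite covers are included: they are padded with empty sets, which
   contribute 0 as k > 0. If there is no countable cover the infimum is +oo. *)
Definition hausdorff_content k (delta : R) A : \bar R :=
  ereal_inf [set (\sum_(0 <= i <oo) (diam (U i) `^ k))%E | U in
    [set U : (set X)^nat | A `<=` \bigcup_i U i /\
                           forall i, (diam (U i) <= delta%:E)%E]].

(* No normalising constant: rescaling the measure by a factor depending on k
   only changes the regularity constants below by that factor. *)
Definition hausdorff_measure k A : \bar R :=
  ereal_sup [set hausdorff_content k delta A | delta in [set d : R | 0 < d]].

(* This is not the library's closed_ball, which is the closure of the open
   ball and can be smaller in a general metric space. *)
Definition cball (x : X) (r : R) : set X := [set y | mdist x y <= r].

(* The endpoint r = diam E is included when diam E is finite. In a general
   metric space r < diam E would not bound the mass of E: arbitrarily many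
   pieces at mutual distance exactly diam E are not seen by such balls. *)
Definition ahlfors_regular_with k C E : Prop :=
  [/\ closed E,
      exists x y, [/\ E x, E y & x != y] &
      forall x (r : R), E x -> 0 < r -> (r%:E <= diam E)%E ->
        ((C^-1 * r `^ k)%:E < hausdorff_measure k (E `&` cball x r) /\
         hausdorff_measure k (E `&` cball x r) < (C * r `^ k)%:E)%E].

Definition ahlfors_regular k E : Prop :=
  exists2 C, 1 < C & ahlfors_regular_with k C E.

Definition big_pieces_with k theta C GG : set (set X) :=
  [set F | ahlfors_regular_with k C F /\
    forall x (r : R), F x -> 0 < r ->
      exists2 G, GG G &
        (theta%:E * hausdorff_measure k (cball x r `&` F) <=
         hausdorff_measure k (cball x r `&` F `&` G))%E].

Definition big_pieces k GG : set (set X) :=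
  [set F | exists theta C, [/\ 0 < theta, 1 < C &
                               big_pieces_with k theta C GG F]].

End Hausdorff.

(* Main.v *)
Require Import Defs.
From HB Require Import structures.
From mathcomp Require Import all_boot all_order all_algebra.
From mathcomp Require Import all_classical all_reals all_analysis.
From mathcomp Require Import finmap ring lra.

Set Implicit Arguments.
Unset Strict Implicit.
Unset Printing Implicit Defensive.

Import Order.TTheory GRing.Theory Num.Theory.
Import numFieldNormedType.Exports.

Local Open Scope classical_set_scope.
Local Open Scope ring_scope.

(** The set [F] is [E] together with one localized member of the inner class
for each of a sparse family of points and scales.

Fix for every [x] in [E] and every dyadic scale [r], at most a top scale of [x],
a member [G] of the inner class covering a fixed fraction of the part of [E] in
the ball at [x] of radius [r]. Three ideas make the construction work.

Localization. The truncation of [G] to a ball can be thin near the sphere. It is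
replaced by a patch ([thicken]) obtained by adding to it surface balls of [G]
with geometrically decreasing radii; the patch stays in the ball of radius
[2 * r], and each of its balls of radius at most [r] contains a comparable
surface ball of [G] lying in the patch ([thicken_ample]).

Selection. Scales are treated in decreasing order. At each scale a maximal
disjoint family of balls of radius [3 * r] avoiding the earlier patches is
chosen. Hence the patches are pairwise disjoint, at distance at least the
smaller of the two radii ([separated_selected]), while by maximality every point
of [E] has, at each scale, a patch of comparable or larger radius nearby
([patch_near]). Separation gives the upper mass bound of [F] in a ball of radius
[r]: at most one patch of radius above [2 * r] meets it, and the small ones are
packed, since the parts of [E] they cover are separated subsets of [E] of mass
comparable to the powers of their radii ([chosen_packing],
[enlargement_measure_le]). As only separated sets occur, additivity of the
Hausdorff measure on sets at positive distance suffices. Separation also makes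
[F] closed, because near a point outside [E] there is at most one patch.

Ampleness. Every ball centred on [F] contains a comparable surface ball of a
member of the inner class lying inside [F] ([ample_enlargement]). Such a ball
carries at once the lower mass bound and, since the member itself has big pieces
of the original class, a big piece for [F] ([ample_big_pieces]).

An unbounded [E] has no largest scale with which to begin the selection. Scales
at [x] are therefore capped by a multiple of the distance to a base point; a
ball of larger radius contains a point of [E] so remote that its cap is
comparable to that radius ([remote_center]). *)

(** * Hausdorff measure as a metric outer measure *)

Section HausdorffMeasure.
Context {R : realType} {X : metricType R}.
Implicit Types (A B U : set X) (k d e : R).
Local Open Scope ereal_scope.

Lemma diam_ge0 A : 0 <= diam A.
Proof. by rewrite le_max lexx. Qed.

Lemma diam_set0 : diam (set0 : set X) = 0.
Proof.
apply/eqP; rewrite eq_le diam_ge0 andbT ge_max lexx /=.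
by apply: ge_ereal_sup => _ [x []].
Qed.

Lemma le_diam A B : A `<=` B -> diam A <= diam B.
Proof.
move=> AB; rewrite /diam ge_max diam_ge0 /= le_max; apply/orP; right.
apply: ereal_sup_le => _ [x Ax [y Ay <-]].
by exists x; [exact: AB|exists y => //; exact: AB].
Qed.

Lemma le_diam_powR k A B : (0 < k)%R -> A `<=` B -> diam A `^ k <= diam B `^ k.
Proof.
move=> k0 AB; apply: gt0_ler_poweR; last exact: le_diam.
- exact: ltW.
- by rewrite in_itv/= leey diam_ge0.
- by rewrite in_itv/= leey diam_ge0.
Qed.

Lemma mdist_le_diam A x y : A x -> A y -> (mdist x y)%:E <= diam A.
Proof.
move=> Ax Ay; rewrite le_max; apply/orP; right.
by apply: ereal_sup_ubound; exists x => //; exists y.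
Qed.

Lemma diam_le A (M : \bar R) : 0 <= M ->
  (forall x y, A x -> A y -> (mdist x y)%:E <= M) -> diam A <= M.
Proof.
move=> M0 AM; rewrite ge_max M0 /=.
by apply: ge_ereal_sup => _ [x Ax [y Ay <-]]; exact: AM.
Qed.

Lemma hausdorff_content_le k d A (U : (set X)^nat) :
  A `<=` \bigcup_i U i -> (forall i, diam (U i) <= d%:E) ->
  hausdorff_content k d A <= \sum_(0 <= i <oo) (diam (U i) `^ k).
Proof. by move=> AU Ud; apply: ereal_inf_lbound; exists U. Qed.

Lemma hausdorff_content_ge k d A M :
  (forall U : (set X)^nat, A `<=` \bigcup_i U i ->
     (forall i, diam (U i) <= d%:E) ->
     M <= \sum_(0 <= i <oo) (diam (U i) `^ k)) ->
  M <= hausdorff_content k d A.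
Proof. by move=> h; apply: le_ereal_inf_tmp => _ [U [AU Ud] <-]; exact: h. Qed.

Lemma hausdorff_content_ge0 k d A : 0 <= hausdorff_content k d A.
Proof.
by apply: hausdorff_content_ge => U _ _; apply: nneseries_ge0 => *; exact: poweR_ge0.
Qed.

Lemma le_hausdorff_content k d d' A B : (d' <= d)%R -> A `<=` B ->
  hausdorff_content k d A <= hausdorff_content k d' B.
Proof.
move=> dd AB; apply: hausdorff_content_ge => U BU Ud.
apply: hausdorff_content_le; first exact: subset_trans BU.
by move=> i; apply: (le_trans (Ud i)); rewrite lee_fin.
Qed.

Lemma hausdorff_content_le_measure k d A : (0 < d)%R ->
  hausdorff_content k d A <= hausdorff_measure k A.
Proof. by move=> d0; apply: ereal_sup_ubound; exists d. Qed.

Lemma hausdorff_measure_ge0 k A : 0 <= hausdorff_measure k A.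
Proof.
apply: le_trans (@hausdorff_content_le_measure k 1%R A ltr01).
exact: hausdorff_content_ge0.
Qed.

Lemma le_hausdorff_measure k A B : A `<=` B ->
  hausdorff_measure k A <= hausdorff_measure k B.
Proof.
move=> AB; apply: ge_ereal_sup => _ [d /= d0 <-].
apply: le_trans (hausdorff_content_le_measure k B d0).
exact: le_hausdorff_content.
Qed.

Lemma hausdorff_measure0 k : (0 < k)%R -> hausdorff_measure k (set0 : set X) = 0.
Proof.
move=> k0; apply/eqP; rewrite eq_le hausdorff_measure_ge0 andbT.
apply: ge_ereal_sup => _ [d /= d0 <-].
have := @hausdorff_content_le k d set0 (fun=> set0) (@sub0set _ _).
rewrite diam_set0 poweR0r ?gt_eqF// eseries0//; apply => _.
by rewrite lee_fin ltW.
Qed.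

Lemma hausdorff_content_sigma_subadditive k d (A : (set X)^nat) :
  hausdorff_content k d (\bigcup_n A n) <=
  \sum_(0 <= n <oo) hausdorff_content k d (A n).
Proof.
have c0 n : 0 <= hausdorff_content k d (A n) by exact: hausdorff_content_ge0.
have [[i ioo]|] := pselect (exists i, hausdorff_content k d (A i) = +oo).
  rewrite (eseries_pinfty _ _ ioo) ?leey// => n _.
  by rewrite -ltNye (lt_le_trans _ (c0 _)).
rewrite -forallNE => Aoo.
apply/lee_addgt0Pr => e e0.
rewrite (le_trans _ (epsilon_trick _ _ (ltW e0)))//.
pose P n (U : (set X)^nat) := [/\ A n `<=` \bigcup_i U i,
  (forall i, diam (U i) <= d%:E) &
  \sum_(0 <= i <oo) (diam (U i) `^ k) <=
    hausdorff_content k d (A n) + (e / (2 ^ n.+1)%:R)%:E].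
have [G PG] : {G : nat -> (set X)^nat & forall n, P n (G n)}.
  apply: (@choice _ _ P) => n.
  have en1 : (0 < e / (2 ^ n.+1)%:R)%R by rewrite divr_gt0// ltr0n expn_gt0.
  have fin : hausdorff_content k d (A n) \is a fin_num.
    by rewrite ge0_fin_numE// ltey; apply/eqP/Aoo.
  have [_ [U [AU Ud] <-] Ue] := lb_ereal_inf_adherent en1 fin.
  by exists U; split => //; exact: ltW.
pose a (ij : nat * nat) := diam (G ij.1 ij.2) `^ k.
have a0 ij : 0 <= a ij by exact: poweR_ge0.
apply: (@le_trans _ _ (\esum_(i in setT) a i)).
  have /card_esym/ppcard_eqP[f] := card_nat2.
  apply: (@le_trans _ _ (\sum_(0 <= i <oo) a (f i))).
    apply: (@hausdorff_content_le k d _ (fun i => G (f i).1 (f i).2)) => [x [n _ Ax]|i].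
      have [AU _ _] := PG n; have [m _ Gx] := AU _ Ax.
      exists (f^-1%FUN (n, m)); first by [].
      by rewrite (invK (mem_set _)).
    by have [_ Ud _] := PG (f i).1; exact: Ud.
  by rewrite -(esum_pred_image a _ xpredT) ?[fun=> _]set_true// image_eq.
have -> : \esum_(i in setT) a i = \sum_(0 <= i <oo) \sum_(0 <= j <oo) a (i, j).
  rewrite nneseries_esumT; last by move=> i; apply: nneseries_ge0.
  transitivity (\esum_(i in [set: nat]) \esum_(j in [set: nat]) a (i, j)); last first.
    by apply: eq_esum => i _; rewrite nneseries_esumT.
  rewrite (@esum_esum _ _ _ setT (fun=> setT) (fun i j => a (i, j)))//.
  rewrite (_ : _ `*`` _ = setT); last by apply/seteqP; split => // -[].
  by apply: eq_esum => -[].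
apply: lee_nneseries => [i _|i _]; first by move=> _; apply: nneseries_ge0.
by have [_ _ h] := PG i.
Qed.

Lemma hausdorff_measure_sigma_subadditive k (A : (set X)^nat) :
  hausdorff_measure k (\bigcup_n A n) <=
  \sum_(0 <= n <oo) hausdorff_measure k (A n).
Proof.
apply: ge_ereal_sup => _ [d /= d0 <-].
apply: (le_trans (hausdorff_content_sigma_subadditive _ _ _)).
apply: lee_nneseries => [n _ _|n _]; first exact: hausdorff_content_ge0.
exact: hausdorff_content_le_measure.
Qed.

Lemma hausdorff_measureU k A B : (0 < k)%R ->
  hausdorff_measure k (A `|` B) <= hausdorff_measure k A + hausdorff_measure k B.
Proof.
move=> k0.
rewrite -bigcup2E; apply: (le_trans (hausdorff_measure_sigma_subadditive _ _)).
rewrite (nneseries_split 0 2) => [|i _]; last exact: hausdorff_measure_ge0.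
rewrite eseries0 => [|i i2 _]; last first.
  by case: i i2 => [|[|i]]//= _; rewrite /bigcup2 hausdorff_measure0.
by rewrite adde0 !big_nat_recr//= big_geq// add0e.
Qed.

(** The mass of a packed family is controlled only through its finite
subfamilies; sigma-subadditivity carries a uniform bound over to the union. *)
Lemma hausdorff_measure_bigcup_le k (J : choiceType) (I : set J)
    (T : J -> set X) M : (0 < k)%R -> countable I ->
  (forall s : seq J, uniq s -> [set` s] `<=` I ->
     \sum_(i <- s) hausdorff_measure k (T i) <= M) ->
  hausdorff_measure k (\bigcup_(i in I) T i) <= M.
Proof.
move=> k0 /countable_injP[f finj] TM.
pose V n := \bigcup_(i in [set i | I i /\ f i = n]) T i.
have -> : \bigcup_(i in I) T i = \bigcup_n V n.
  apply/seteqP; split => x.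
    by move=> [i Ii Tx]; exists (f i) => //; exists i.
  by move=> [n _ [i [Ii _] Tx]]; exists i.
apply: (le_trans (hausdorff_measure_sigma_subadditive _ _)).
rewrite nneseries_esumT; last by move=> n; exact: hausdorff_measure_ge0.
have -> : \esum_(n in [set: nat]) hausdorff_measure k (V n) =
    \esum_(n in f @` I) hausdorff_measure k (V n).
  rewrite [RHS]esum_mkcond; apply: eq_esum => n _; case: ifPn => //.
  rewrite notin_setE => nI; rewrite (_ : V n = set0) ?hausdorff_measure0//.
  by apply/seteqP; split => // x [i [Ii fi] _]; apply: nI; exists i.
rewrite esum_image//.
apply: ge_ereal_sup => _ [A [finA AI] <-].
rewrite fsbig_finite//=.
have AE i : (i \in fset_set A) = (i \in A) by rewrite in_fset_set.
rewrite (eq_big_seq (fun i => hausdorff_measure k (T i))).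
  by apply: TM => [|i /=]; [exact: fset_uniq|rewrite AE => /set_mem/AI].
move=> i; rewrite AE => /set_mem/AI Ii; congr (hausdorff_measure k _).
apply/seteqP; split => x; last by move=> Tx; exists i.
by move=> [j [Ij /finj]] => /(_ (mem_set Ij) (mem_set Ii)) ->.
Qed.

Definition separated e A B := forall x y, A x -> B y -> (e <= mdist x y)%R.

(** A set of diameter at most [d] cannot meet both of two sets at distance [2 d],
so a fine cover of the union splits into covers of the two parts. *)
Lemma hausdorff_content_separated k d A B : (0 < k)%R -> (0 < d)%R ->
  separated (d *+ 2) A B ->
  hausdorff_content k d A + hausdorff_content k d B <=
  hausdorff_content k d (A `|` B).
Proof.
move=> k0 d0 AB; apply: hausdorff_content_ge => U ABU Ud.
(* [V C i] is [U i] when it meets [C], and empty otherwise. *)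
pose V C i := [set x | U i x /\ exists2 y, U i y & C y].
have VU C i : V C i `<=` U i by move=> x [].
have VD C i : diam (V C i) <= d%:E.
  by apply: le_trans (Ud i); exact/le_diam/VU.
have cov C : C `<=` A `|` B -> hausdorff_content k d C <=
    \sum_(0 <= i <oo) (diam (V C i) `^ k).
  move=> CAB; apply: hausdorff_content_le => // x Cx.
  by have [i _ Ux] := ABU _ (CAB _ Cx); exists i => //; split => //; exists x.
apply: (le_trans (leeD (cov A (@subsetUl _ _ _)) (cov B (@subsetUr _ _ _)))).
rewrite -nneseriesD; [|by move=> *; exact: poweR_ge0..].
apply: lee_nneseries => [i _ _|i _]; first by rewrite adde_ge0// poweR_ge0.
have [[x Ux Ax]|nA] := pselect (exists2 x, U i x & A x); last first.
  rewrite (_ : V A i = set0); last by apply/seteqP; split => // x [].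
  rewrite diam_set0 poweR0r ?gt_eqF// add0e; exact: le_diam_powR k0 (VU B i).
have [[y Uy By]|nB] := pselect (exists2 x, U i x & B x); last first.
  rewrite (_ : V B i = set0); last by apply/seteqP; split => // y [].
  rewrite diam_set0 poweR0r ?gt_eqF// adde0; exact: le_diam_powR k0 (VU A i).
exfalso; have := le_trans (mdist_le_diam Ux Uy) (Ud i).
have := AB _ _ Ax By; rewrite lee_fin; lra.
Qed.

Lemma hausdorff_measure_separated k e A B : (0 < k)%R -> (0 < e)%R ->
  separated e A B ->
  hausdorff_measure k A + hausdorff_measure k B <= hausdorff_measure k (A `|` B).
Proof.
move=> k0 e0 AB.
have [->|] := eqVneq (hausdorff_measure k (A `|` B)) +oo; first by rewrite leey.
rewrite -ltey => ABfin.
have fin C : C `<=` A `|` B -> hausdorff_measure k C \is a fin_num.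
  move=> CAB; rewrite ge0_fin_numE ?hausdorff_measure_ge0//.
  exact: le_lt_trans (le_hausdorff_measure k CAB) ABfin.
rewrite -leeBrDr ?fin//; apply: ge_ereal_sup => _ [d1 /= d10 <-].
have cfin : hausdorff_content k d1 A \is a fin_num.
  rewrite ge0_fin_numE ?hausdorff_content_ge0//.
  apply: le_lt_trans (hausdorff_content_le_measure k A d10) _.
  by rewrite ltey_eq fin.
rewrite leeBrDr ?fin// addeC -leeBrDr//.
apply: ge_ereal_sup => _ [d2 /= d20 <-].
rewrite leeBrDr// addeC.
pose d := Num.min (Num.min d1 d2) (e / 2)%R.
have d0 : (0 < d)%R by rewrite !lt_min d10 d20 divr_gt0.
apply: le_trans (hausdorff_content_le_measure k _ d0).
apply: le_trans (hausdorff_content_separated k0 d0 _).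
  by apply: leeD; apply: le_hausdorff_content => //; rewrite /d !ge_min lexx ?orbT.
move=> x y Ax By; apply: le_trans (AB _ _ Ax By).
by rewrite -mulr_natr -ler_pdivlMr// /d ge_min lexx orbT.
Qed.

(** The common lower bound on the distances separates each piece from the union
of the others, so the pieces can be split off one at a time. *)
Lemma sum_hausdorff_measure_separated k e (J : eqType) (s : seq J)
    (P : J -> set X) A : (0 < k)%R -> (0 < e)%R -> uniq s ->
  (forall i j, i \in s -> j \in s -> i != j -> separated e (P i) (P j)) ->
  (forall i, i \in s -> P i `<=` A) ->
  \sum_(i <- s) hausdorff_measure k (P i) <= hausdorff_measure k A.
Proof.
move=> k0 e0 + Psep PA.
suff : uniq s -> \sum_(i <- s) hausdorff_measure k (P i) <=
    hausdorff_measure k (\bigcup_(i in [set` s]) P i).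
  move=> + us => /(_ us) h; apply: (le_trans h); apply: le_hausdorff_measure.
  by move=> x [i /= si]; exact: PA.
elim: s Psep {PA} => [|i s IH] Psep; first by rewrite big_nil hausdorff_measure_ge0.
move=> /= /andP[is_ us]; rewrite big_cons.
have {}IH : \sum_(i <- s) hausdorff_measure k (P i) <=
    hausdorff_measure k (\bigcup_(i in [set` s]) P i).
  by apply: IH => // j l js ls; apply: Psep; rewrite inE ?js ?ls orbT.
apply: (le_trans (leeD2l _ IH)).
apply: le_trans (hausdorff_measure_separated k0 e0 _) _.
  move=> x y Px [j /= js Py]; apply: (Psep i j) Px Py; rewrite ?inE ?eqxx ?js ?orbT//.
  by apply: contraNneq is_ => ->.
apply: le_hausdorff_measure => x [Px|[j /= js Pjx]].
  by exists i => //=; rewrite inE eqxx.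
by exists j => //=; rewrite inE js orbT.
Qed.

End HausdorffMeasure.

(** * Metric preliminaries and regular sets *)

Section Metric.
Context {R : realType} {X : metricType R}.
Implicit Types (A E G U : set X) (x y z p q : X) (r s t e k C m : R).

Lemma closure_mdistP A p :
  closure A p <-> forall e, 0 < e -> exists2 q, A q & mdist p q < e.
Proof.
split=> [Ap e e0|h B /nbhs_ballP[e /= e0 peB]].
  have [q [Aq]] := Ap _ (nbhsx_ballx p e e0).
  by rewrite ballEmdist => pq; exists q.
have [q Aq pq] := h e e0; exists q; split => //; apply: peB.
by rewrite ballEmdist.
Qed.

(** The minimum covers [s > r], where already [n = 0] is admissible. *)
Lemma dyadic_scale r s : 0 < r -> 0 < s ->
  exists n, r / 2 ^+ n <= s /\ Num.min s r <= 2 * (r / 2 ^+ n).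
Proof.
move=> r0 s0.
have exn : exists n, r / 2 ^+ n <= s.
  have [n] : exists n : nat, r / s < n%:R.
    by exists (Num.bound (r / s)); rewrite archi_boundP// divr_ge0 ?ltW.
  move=> rn; exists n; rewrite ler_pdivrMr ?exprn_gt0// mulrC -ler_pdivrMr//.
  by rewrite ltW// (lt_le_trans rn)// -natrX ler_nat ltnW// ltn_expl.
have [[|n] ns nmin] := ex_minnP exn.
  exists 0%N; split => //; rewrite ge_min expr0 divr1; apply/orP; right; lra.
exists n.+1; split => //; rewrite ge_min; apply/orP; left.
have : s < r / 2 ^+ n by rewrite ltNge; apply/negP => /nmin; rewrite ltnn.
have -> : r / 2 ^+ n = 2 * (r / 2 ^+ n.+1).
  by rewrite exprS invfM; field; rewrite expf_neq0.
exact: ltW.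
Qed.

Lemma powR_cancel k r : 0 < k -> 0 <= r -> (r `^ k^-1) `^ k = r.
Proof. by move=> k0 r0; rewrite -powRrM mulVf ?gt_eqF// powRr1. Qed.

Lemma le_powR k r s : 0 < k -> 0 <= r -> r <= s -> r `^ k <= s `^ k.
Proof.
move=> k0 r0 rs; apply: ge0_ler_powR; rewrite ?nnegrE//; first exact: ltW.
exact: le_trans rs.
Qed.

Lemma diam_lt_fin A r : (diam A < r%:E)%E -> exists2 D, diam A = D%:E & 0 <= D < r.
Proof.
move=> Ar; have Afin : diam A \is a fin_num.
  by rewrite ge0_fin_numE ?diam_ge0// (lt_trans Ar) ?ltry.
exists (fine (diam A)); first by rewrite fineK.
by rewrite -lee_fin -lte_fin fineK// diam_ge0.
Qed.

Lemma diam_cball E x D : E x -> diam E = D%:E -> E `<=` cball x D.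
Proof. by move=> Ex ED y Ey; have := mdist_le_diam Ex Ey; rewrite ED lee_fin. Qed.

Lemma diam_gt0 E x y : E x -> E y -> x != y -> (0 < diam E)%E.
Proof.
by move=> Ex Ey xy; apply: lt_le_trans (mdist_le_diam Ex Ey); rewrite lte_fin mdist_gt0.
Qed.

Lemma regular_diam_gt0 k C E : ahlfors_regular_with k C E -> (0 < diam E)%E.
Proof. by move=> [_ [x [y [Ex Ey xy]]] _]; exact: diam_gt0 Ex Ey xy. Qed.

(** The upper bound extends to radii beyond the diameter, where the ball
swallows the whole set. *)
Lemma regular_measure_le k C E x r : 0 < k -> 1 < C ->
  ahlfors_regular_with k C E -> E x -> 0 < r ->
  (hausdorff_measure k (E `&` cball x r) <= (C * r `^ k)%:E)%E.
Proof.
move=> k0 C1 Ereg Ex r0; have [_ _ reg] := Ereg.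
have [rE|] := leP r%:E (diam E); first exact: ltW (reg x r Ex r0 rE).2.
move=> /diam_lt_fin[D ED /andP[D0 Dr]].
have {}D0 : 0 < D by rewrite -lte_fin -ED (regular_diam_gt0 Ereg).
apply: (@le_trans _ _ (hausdorff_measure k (E `&` cball x D))).
  by apply: le_hausdorff_measure => y [Ey _]; split => //; exact: diam_cball ED y Ey.
apply: ltW; apply: lt_le_trans (reg x D Ex D0 _).2 _; first by rewrite ED.
by rewrite lee_fin ler_wpM2l ?(ltW (lt_trans ltr01 C1))// le_powR// ltW.
Qed.

(** Enlarging a radius by this factor turns the lower mass bound into the upper
one. *)
Definition annulus_ratio k C : R := (C ^+ 2) `^ k^-1.

Lemma annulus_ratio_ge1 k C : 0 < k -> 1 < C -> 1 <= annulus_ratio k C.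
Proof.
move=> k0 C1; have := @le_powR k^-1 1 (C ^+ 2); rewrite powR1 invr_gt0.
by apply => //; nra.
Qed.

(** If the annulus were empty, the lower bound at the large radius would
contradict the upper bound at the small one. *)
Lemma regular_annulus k C E x t : 0 < k -> 1 < C ->
  ahlfors_regular_with k C E -> E x -> 0 < t ->
  ((annulus_ratio k C * t)%:E <= diam E)%E ->
  exists2 y, E y & t < mdist x y <= annulus_ratio k C * t.
Proof.
move=> k0 C1 Ereg Ex t0 tE; set A := annulus_ratio k C in tE *.
have A1 : 1 <= A by exact: annulus_ratio_ge1.
have At0 : 0 < A * t by rewrite mulr_gt0//; lra.
apply: contrapT => noy.
have sub : E `&` cball x (A * t) `<=` E `&` cball x t.
  move=> y [Ey xy]; split => //; rewrite /cball/= leNgt; apply/negP => txy.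
  by apply: noy; exists y => //; rewrite txy.
have [_ _ /(_ x _ Ex At0 tE)[+ _]] := Ereg.
apply/negP; rewrite -leNgt; apply: (le_trans (le_hausdorff_measure k sub)).
apply: (le_trans (regular_measure_le k0 C1 Ereg Ex t0)).
rewrite lee_fin powRM; [|lra|exact: ltW].
rewrite /A /annulus_ratio powR_cancel ?sqr_ge0// le_eqVlt; apply/orP; left.
by apply/eqP; field; rewrite gt_eqF//; lra.
Qed.

(** A bounded regular set is one of its own balls, so its mass bounds its
diameter from below. *)
Lemma regular_diam_ge k C m G z r : 0 < k -> 1 < C -> 0 < m -> 0 < r ->
  ahlfors_regular_with k C G -> G z ->
  ((m * r `^ k)%:E <= hausdorff_measure k G)%E ->
  (((m / C) `^ k^-1 * r)%:E <= diam G)%E.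
Proof.
move=> k0 C1 m0 r0 Greg Gz mG; rewrite leNgt; apply/negP.
move=> /diam_lt_fin[D GD /andP[D0 Dr]].
have {}D0 : 0 < D by rewrite -lte_fin -GD (regular_diam_gt0 Greg).
have [_ _ /(_ z D Gz D0)[|_]] := Greg; first by rewrite GD.
rewrite (_ : G `&` _ = G); last first.
  by apply/setIidPl; exact: diam_cball GD.
move=> /(le_lt_trans mG); rewrite lte_fin ltNge => /negP; apply.
have C0 : 0 < C by lra.
have -> : m * r `^ k = C * ((m / C) `^ k^-1 * r) `^ k.
  rewrite powRM ?powR_ge0 ?ltW// powR_cancel ?divr_ge0 ?ltW//.
  by field; rewrite gt_eqF.
by rewrite ler_wpM2l ?(ltW C0)// le_powR// ltW.
Qed.

End Metric.

(** * Localizing a set to a ball *)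

Section Thicken.
Context {R : realType} {X : metricType R}.
Implicit Types (G : set X) (y p q : X) (r s t : R).

(** The radii of the added balls sum up to [r], which keeps all steps in the ball
of radius [2 * r]. *)
Fixpoint thicken_step G y r (j : nat) : set X :=
  if j is i.+1 then
    [set p | G p /\ exists2 q, thicken_step G y r i q & mdist q p <= r / 2 ^+ i.+1]
  else G `&` cball y r.

Definition thicken G y r : set X := closure (\bigcup_j thicken_step G y r j).

Lemma thicken_step_sub G y r j : thicken_step G y r j `<=` G.
Proof. by case: j => [|j] p []. Qed.

Lemma thicken_stepS G y r j : 0 < r ->
  thicken_step G y r j `<=` thicken_step G y r j.+1.
Proof.
move=> r0 p jp; split; first exact: thicken_step_sub jp.
by exists p => //; rewrite mdistxx divr_ge0 ?exprn_ge0 ?ltW.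
Qed.

Lemma le_thicken_step G y r i j : 0 < r -> (i <= j)%N ->
  thicken_step G y r i `<=` thicken_step G y r j.
Proof.
move=> r0 /subnK <-; elim: (j - i)%N => // n IH p ip.
by rewrite addSn; apply: thicken_stepS => //; exact: IH.
Qed.

Lemma thicken_step_chain G y r i j p : 0 < r -> (i <= j)%N ->
  thicken_step G y r j p ->
  exists2 q, thicken_step G y r i q & mdist q p <= r / 2 ^+ i - r / 2 ^+ j.
Proof.
move=> r0 /subnK <-; elim: (j - i)%N p => [p ip|n IH p].
  by exists p => //; rewrite add0n subrr mdistxx.
rewrite addSn => -[_ [q /IH[q' iq' q'q] qp]]; exists q' => //.
have := metric_triangle q' q p.
have : r / 2 ^+ (n + i) = 2 * (r / 2 ^+ (n + i).+1).
  by rewrite exprS invfM; field; rewrite expf_neq0.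
lra.
Qed.

Lemma closed_thicken G y r : closed (thicken G y r).
Proof. exact: closed_closure. Qed.

Lemma thicken_sub G y r : closed G -> thicken G y r `<=` G.
Proof.
move=> cG p pt; apply: cG; apply: closureS pt => q [j _].
exact: thicken_step_sub.
Qed.

Lemma sub_thicken G y r : G `&` cball y r `<=` thicken G y r.
Proof. by move=> p Gp; apply: subset_closure; exists 0%N. Qed.

Lemma thicken_sub_cball G y r : 0 < r -> thicken G y r `<=` cball y (2 * r).
Proof.
move=> r0 p /closure_mdistP pcl; rewrite /cball/=; apply/ler_addgt0Pr => e e0.
have [q [j _ jq] pq] := pcl e e0.
have [q' [_ yq'] q'q] := thicken_step_chain r0 (leq0n j) jq.
rewrite /cball/= in yq'; rewrite expr0 in q'q.
have : 0 < r / 2 ^+ j by rewrite divr_gt0// exprn_gt0.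
have := metric_triangle y q' p; have := metric_triangle q' q p.
rewrite (metric_sym q p); lra.
Qed.

(** Every point is reached by a chain with step sizes [r / 2 ^+ j], so at any
scale some earlier point of the chain is close by; the next step added a full
ball of [G] around that point. *)
Lemma thicken_ample G y r p s : 0 < r -> 0 < s -> s <= r -> thicken G y r p ->
  exists q t, [/\ G q, s / 16 <= t, t <= r, mdist p q + t <= s &
    G `&` cball q t `<=` thicken G y r].
Proof.
move=> r0 s0 sr /closure_mdistP pcl.
have s20 : 0 < s / 2 by rewrite divr_gt0.
have s40 : 0 < s / 4 by rewrite divr_gt0.
have [p' [j _ jp'] pp'] := pcl _ s20.
have [i [ris si]] := dyadic_scale r0 s40.
have {}si : s / 4 <= 2 * (r / 2 ^+ i).
  by move: si; rewrite min_l//; lra.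
(* A point from a step before [i] serves itself, the steps being increasing. *)
have [q iq qp'] : exists2 q, thicken_step G y r i q & mdist q p' <= r / 2 ^+ i.
  have [ij|/ltnW ji] := leqP i j.
    have [q iq qp'] := thicken_step_chain r0 ij jp'; exists q => //.
    by have : 0 < r / 2 ^+ j; [rewrite divr_gt0// exprn_gt0|lra].
  exists p'; first exact: le_thicken_step ji _ jp'.
  by rewrite mdistxx divr_ge0 ?exprn_ge0 ?ltW.
have riE : r / 2 ^+ i = 2 * (r / 2 ^+ i.+1).
  by rewrite exprS invfM; field; rewrite expf_neq0.
exists q, (r / 2 ^+ i.+1); split.
- exact: thicken_step_sub iq.
- lra.
- lra.
- have := metric_triangle p p' q; rewrite (metric_sym p' q); lra.
- move=> z [Gz qz]; apply: subset_closure; exists i.+1 => //; split => //.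
  by exists q.
Qed.

End Thicken.

(** * Selecting separated pieces scale by scale *)

Section Selection.
Context {R : realType} {X : metricType R}.
Variables (E : set X) (rad : X -> nat -> R) (T : X -> nat -> set X).
Hypothesis rad_gt0 : forall x n, 0 < rad x n.
Hypothesis T_sub : forall x n, E x -> T x n `<=` cball x (2 * rad x n).

(** Pieces live in the doubled balls; the third radius is what separates them. *)
Let B n x := cball x (3 * rad x n).

Definition selection (U : set X) n : set X :=
  sval (ex_maximal_disjoint_subcollection (B n) [set x | E x /\ B n x `&` U = set0]).

(** Stages are numbered by decreasing scale, so that [used n] collects the pieces
already placed at the scales above stage [n]. *)
Fixpoint used n : set X :=
  if n is m.+1 then
    used m `|` \bigcup_(y in selection (used m) m) T y m
  else set0.

Definition selected : set (X * nat) := [set i | selection (used i.2) i.2 i.1].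

Lemma selection_max n : maximal_disjoint_subcollection (B n)
  (selection (used n) n) [set x | E x /\ B n x `&` used n = set0].
Proof. by rewrite /selection; case: ex_maximal_disjoint_subcollection. Qed.

Lemma selectedE i : selected i -> E i.1.
Proof. by move=> si; have [sub _ _] := selection_max i.2; have [] := sub _ si. Qed.

Lemma usedP n p : used n p <-> exists i, [/\ selected i, (i.2 < n)%N & T i.1 i.2 p].
Proof.
elim: n => [|n IH]; first by split => // -[i [_]].
split=> [[/IH[i [si ? ?]]|[y sy Tp]]|[i [si + Tp]]].
- by exists i; split => //; apply: leqW.
- by exists (y, n).
- rewrite ltnS leq_eqVlt => /orP[/eqP ni|lt_in].
    by right; exists i.1; rewrite -ni.
  by left; apply/IH; exists i.
Qed.

(** A later piece keeps the distance of its own radius from every earlier one: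
the tripled ball of its centre avoids them. *)
Lemma separated_earlier i j : selected i -> selected j -> (i.2 < j.2)%N ->
  separated (rad j.1 j.2) (T i.1 i.2) (T j.1 j.2).
Proof.
move=> si sj ij p q Tp Tq.
have [/(_ _ sj)[Ej Bj] _ _] := selection_max j.2.
have jq := T_sub Ej Tq; rewrite /cball/= in jq.
have : ~ B j.2 j.1 p.
  move=> jp; suff : (B j.2 j.1 `&` used j.2) p by rewrite Bj.
  by split => //; apply/usedP; exists i.
rewrite /B /cball/= => /negP; rewrite -ltNge => jp.
have := metric_triangle j.1 q p; rewrite (metric_sym q p); lra.
Qed.

Lemma separated_selected i j : selected i -> selected j -> i != j ->
  separated (Num.min (rad i.1 i.2) (rad j.1 j.2)) (T i.1 i.2) (T j.1 j.2).
Proof.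
move=> si sj ij p q Tp Tq; rewrite ge_min.
have [lt_ij|lt_ji|eq_ij] := ltngtP i.2 j.2.
- by rewrite (separated_earlier si sj lt_ij Tp Tq) orbT.
- by rewrite metric_sym (separated_earlier sj si lt_ji Tq Tp).
(* At equal stages the tripled balls themselves are disjoint. *)
- have [_ triv _] := selection_max i.2.
  have {}ij : i.1 != j.1.
    apply: contraNneq ij => ij1.
    by rewrite (surjective_pairing i) (surjective_pairing j) ij1 eq_ij.
  have : ~ B i.2 i.1 q.
    move=> iq; move/eqP: ij; apply; apply: triv => //.
      by move: sj; rewrite /selected/= -eq_ij.
    exists q; split => //; have := T_sub (selectedE sj) Tq.
    by have := rad_gt0 j.1 j.2; rewrite /B eq_ij /cball/=; lra.
  have := T_sub (selectedE si) Tp.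
  rewrite /B /cball/= => ip /negP; rewrite -ltNge => iq.
  apply/orP; left.
  have := metric_triangle i.1 p q; lra.
Qed.

(** Maximality: a centre that was passed over at stage [n] is close to a piece
of an earlier stage, or to another centre of the same stage. *)
Lemma selected_near x n : E x ->
  (exists i z, [/\ selected i, (i.2 < n)%N, T i.1 i.2 z & mdist x z <= 3 * rad x n]) \/
  (exists y, selected (y, n) /\ mdist x y <= 3 * rad x n + 3 * rad y n).
Proof.
move=> Ex.
have [meets|nomeet] := pselect (B n x `&` used n !=set0).
  by left; have [z [xz /usedP[i [si lt_in Tz]]]] := meets; exists i, z.
right; have [sub triv maxi] := selection_max n.
apply: contrapT => noy.
have far y : selection (used n) n y -> ~ (B n x `&` B n y !=set0).
  move=> sy [w [xw yw]]; apply: noy; exists y; split => //.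
  rewrite /B /cball/= in xw yw.
  have := metric_triangle x w y; rewrite (metric_sym w y); lra.
have Bxx : B n x x by rewrite /B /cball/= mdistxx mulr_ge0// ltW.
(* Otherwise [x] could be added to the family of stage [n]. *)
apply: (maxi (selection (used n) n `|` [set x])).
- split; last by move=> /(_ x (or_intror erefl)) /far; apply; exists x.
  exact: subsetUl.
- move=> y [/sub//|->]; split => //.
  by apply/seteqP; split => // z ?; apply: nomeet; exists z.
- move=> y z [sy|->] [sz|->] // yz; first exact: triv yz.
    by exfalso; apply: (far _ sy); rewrite setIC.
  by exfalso; exact: (far _ sz).
Qed.

End Selection.

(** * Ample sets *)

Section Ample.
Context {R : realType} {X : metricType R}.
Implicit Types (F G : set X) (GG FF : set (set X)) (p q : X).
Implicit Types (r s t k kappa theta C : R).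

(** The surface ball of [G] has to lie in [F] as a whole: then the mass of [G]
and its big pieces there are also found in [F]. *)
Definition ample GG F kappa p s := exists G q t,
  [/\ GG G, G q & (t%:E <= diam G)%E] /\
  [/\ kappa * s <= t, mdist p q + t <= s & G `&` cball q t `<=` F].

Lemma ample_trans GG F kappa p s kappa' p' s' : ample GG F kappa p s ->
  mdist p' p + s <= s' -> kappa' * s' <= kappa * s -> ample GG F kappa' p' s'.
Proof.
move=> [G [q [t [Gq [st pq GF]]]]] pp' ss'; exists G, q, t; split => //; split => //.
  lra.
by have := metric_triangle p' p q; lra.
Qed.

(** Being ample at every point and scale yields both the lower mass bound and
the big pieces, as each is inherited from the member of [GG] found there. *)
Lemma ample_big_pieces GG FF F k theta C kappa C' :
  0 < k -> 0 < theta -> 1 < C -> 0 < kappa -> 1 < C' ->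
  GG `<=` big_pieces_with k theta C FF ->
  closed F -> (exists x y, [/\ F x, F y & x != y]) ->
  (forall p r, 0 < r -> (hausdorff_measure k (F `&` cball p r) <= (C' * r `^ k)%:E)%E) ->
  (forall p s, F p -> 0 < s -> (s%:E <= diam F)%E -> ample GG F kappa p s) ->
  let C'' := C' + C / kappa `^ k in
  ahlfors_regular_with k C'' F /\
  big_pieces_with k (theta * kappa `^ k / (C * C')) C'' FF F.
Proof.
move=> k0 theta0 C1 kappa0 C'1 GGbp Fcl F2 Fup Famp C''.
have C0 : 0 < C by lra.
have C'0 : 0 < C' by lra.
have K0 : 0 < kappa `^ k by exact: powR_gt0.
have CK0 : 0 < C / kappa `^ k by rewrite divr_gt0.
have F0 : (0 < diam F)%E by have [x [y [Fx Fy xy]]] := F2; exact: diam_gt0 Fx Fy xy.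
have lower G q t s : ahlfors_regular_with k C G -> G q -> 0 < s ->
    (t%:E <= diam G)%E -> kappa * s <= t ->
    ((C^-1 * kappa `^ k * s `^ k)%:E < hausdorff_measure k (G `&` cball q t))%E.
  move=> [_ _ Greg] Gq s0 tG st.
  have t0 : 0 < t by apply: lt_le_trans st; exact: mulr_gt0.
  apply: le_lt_trans (Greg q t Gq t0 tG).1.
  rewrite lee_fin -mulrA -powRM ?(ltW kappa0) ?(ltW s0)//.
  apply: ler_wpM2l; first by rewrite invr_ge0 ltW.
  by apply: le_powR => //; rewrite mulr_ge0 ?ltW.
have Freg : ahlfors_regular_with k C'' F.
  split => // p s Fp s0 sF; split.
    have [G [q [t [[/GGbp[Greg _] Gq tG] [st pq GF]]]]] := Famp p s Fp s0 sF.
    apply: (@lt_le_trans _ _ (hausdorff_measure k (G `&` cball q t))); last first.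
      apply: le_hausdorff_measure => z [Gz qz]; split; first exact: GF.
      by rewrite /cball/= in qz *; have := metric_triangle p q z; lra.
    apply: le_lt_trans (lower _ _ _ _ Greg Gq s0 tG st).
    rewrite lee_fin ler_wpM2r ?powR_ge0//.
    have -> : C^-1 * kappa `^ k = (C / kappa `^ k)^-1 by rewrite invf_div mulrC.
    by rewrite lef_pV2 ?posrE// /C''; lra.
  apply: (le_lt_trans (Fup p s s0)); rewrite lte_fin ltr_pM2r ?powR_gt0//.
  by rewrite /C''; lra.
split; first exact: Freg.
split=> // p r0 Fp r00.
(* Beyond the diameter the ball is all of [F], as it is at [r = diam F]. *)
have [r [r_gt0 rF rE]] : exists r, [/\ 0 < r, (r%:E <= diam F)%E &
    cball p r `&` F = cball p r0 `&` F /\ r <= r0].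
  have [rF|] := leP r0%:E (diam F); first by exists r0.
  move=> /diam_lt_fin[D FD /andP[_ Dr]]; exists D; rewrite FD; split => //.
    by rewrite -lte_fin -FD.
  split; last exact: ltW.
  apply/seteqP; split => z [pz Fz]; split => //; last exact: (diam_cball Fp FD).
  exact: le_trans pz (ltW Dr).
have [G [q [t [[/GGbp[Greg Gbp] Gq tG] [st pq GF]]]]] := Famp p r Fp r_gt0 rF.
have t0 : 0 < t by apply: lt_le_trans st; exact: mulr_gt0.
have [G' FFG' G'big] := Gbp q t Gq t0; exists G' => //.
apply: (@le_trans _ _ (theta%:E * hausdorff_measure k (cball q t `&` G))%E).
  rewrite -rE.1.
  apply: (@le_trans _ _ (theta%:E * (C^-1 * kappa `^ k * r `^ k)%:E)%E); last first.
    apply: lee_wpmul2l; first by rewrite lee_fin ltW.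
    by rewrite setIC; exact/ltW/(lower _ _ _ _ Greg Gq r_gt0 tG st).
  apply: (@le_trans _ _ ((theta * kappa `^ k / (C * C'))%:E * (C' * r `^ k)%:E)%E).
    apply: lee_wpmul2l; last by rewrite setIC; exact: Fup.
    by rewrite lee_fin ltW// divr_gt0 ?mulr_gt0.
  rewrite -!EFinM lee_fin le_eqVlt; apply/orP; left; apply/eqP; field.
  by rewrite !gt_eqF.
apply: (le_trans G'big); apply: le_hausdorff_measure => z [[qz Gz] G'z].
split => //; split; last exact: GF.
rewrite /cball/= in qz *; have := metric_triangle p q z; lra.
Qed.

End Ample.

(** * Enlarging a set by thickened pieces *)

Section Enlargement.
Context {R : realType} {X : metricType R}.
Variables (k theta C1 C2 : R).
Hypotheses (k_gt0 : 0 < k) (theta_gt0 : 0 < theta) (C1_gt1 : 1 < C1) (C2_gt1 : 1 < C2).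
Variables (E : set X) (GG : set (set X)) (piece : X -> R -> set X).
Hypothesis Ereg : ahlfors_regular_with k C1 E.
Hypothesis GGreg : forall G, GG G -> ahlfors_regular_with k C2 G.
Hypothesis pieceGG : forall x r, E x -> 0 < r -> GG (piece x r).
Hypothesis piece_big : forall x r, E x -> 0 < r ->
  (theta%:E * hausdorff_measure k (cball x r `&` E) <=
   hausdorff_measure k (cball x r `&` E `&` piece x r))%E.
Variables (x0 : X) (s0 : R).
Hypotheses (Ex0 : E x0) (s0_gt0 : 0 < s0) (s0E : (s0%:E <= diam E)%E).
Hypothesis diamE : diam E = s0%:E \/ diam E = +oo%E.
Implicit Types (x y z p q : X) (i j : X * nat) (n : nat) (r s t : R).

Let C1_gt0 : 0 < C1. Proof. exact: lt_trans ltr01 C1_gt1. Qed.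
Let C2_gt0 : 0 < C2. Proof. exact: lt_trans ltr01 C2_gt1. Qed.

(** For a bounded set this is the constant [s0 = diam E]; for an unbounded one it
grows with the distance to the base point. The slope [1 / 9] is small enough for
two centres whose tripled balls meet to have comparable top scales. *)
Definition top_scale x : R := Num.max s0 (mdist x x0 / 9).

Definition rad x n : R := top_scale x / 2 ^+ n.

Definition patch x n : set X := thicken (piece x (rad x n)) x (rad x n).

(** The part of [E] captured by the piece at [i]; its mass pays for the patch. *)
Definition core i : set X :=
  cball i.1 (rad i.1 i.2) `&` E `&` piece i.1 (rad i.1 i.2).

Notation chosen := (selected E rad patch).

Definition enlargement : set X := E `|` \bigcup_(i in chosen) patch i.1 i.2.

Lemma top_scale_ge x : s0 <= top_scale x.
Proof. by rewrite le_max lexx. Qed.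

Lemma top_scale_gt0 x : 0 < top_scale x.
Proof. exact: lt_le_trans (top_scale_ge x). Qed.

Lemma rad_gt0 x n : 0 < rad x n.
Proof. by rewrite divr_gt0 ?top_scale_gt0// exprn_gt0. Qed.

Lemma rad_le_top x n : rad x n <= top_scale x.
Proof.
by rewrite ler_pdivrMr ?exprn_gt0// ler_peMr ?exprn_ege1 ?ler1n// ltW// top_scale_gt0.
Qed.

Lemma top_scale_lip x y : top_scale x <= top_scale y + mdist x y / 9.
Proof.
have xy0 := mdist_ge0 x y.
have := metric_triangle x y x0.
rewrite {1}/top_scale ge_max => tri; apply/andP; split.
  by have := top_scale_ge y; lra.
have : mdist y x0 / 9 <= top_scale y by rewrite le_max lexx orbT.
lra.
Qed.

Lemma top_scale_le_diam x : E x -> ((top_scale x)%:E <= diam E)%E.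
Proof.
move=> Ex; rewrite /top_scale EFin_max ge_max s0E /=.
apply: le_trans (mdist_le_diam Ex Ex0); rewrite lee_fin.
by have := mdist_ge0 x x0; lra.
Qed.

Lemma rad_le_diam x n : E x -> ((rad x n)%:E <= diam E)%E.
Proof.
move=> Ex; apply: le_trans (top_scale_le_diam Ex).
by rewrite lee_fin rad_le_top.
Qed.

Lemma patch_sub_cball x n : patch x n `<=` cball x (2 * rad x n).
Proof. exact/thicken_sub_cball/rad_gt0. Qed.

Lemma piece_reg x r : E x -> 0 < r -> ahlfors_regular_with k C2 (piece x r).
Proof. by move=> Ex r0; exact/GGreg/pieceGG. Qed.

Lemma patch_sub_piece x n : E x -> patch x n `<=` piece x (rad x n).
Proof. by move=> Ex; apply: thicken_sub; have [] := piece_reg Ex (rad_gt0 x n). Qed.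

Lemma core_sub_patch i : core i `<=` patch i.1 i.2.
Proof. by move=> z [[? ?] ?]; exact: sub_thicken. Qed.

Lemma core_measure_ge i : E i.1 ->
  ((theta / C1 * rad i.1 i.2 `^ k)%:E <= hausdorff_measure k (core i))%E.
Proof.
move=> Ei; apply: le_trans (piece_big Ei (rad_gt0 _ _)).
rewrite -mulrA EFinM; apply: lee_wpmul2l; first by rewrite lee_fin ltW.
have [_ _ reg] := Ereg; rewrite setIC; apply: ltW.
exact: (reg _ _ Ei (rad_gt0 _ _) (rad_le_diam i.2 Ei)).1.
Qed.

Lemma core_nonempty i : E i.1 -> core i !=set0.
Proof.
move=> Ei; apply/set0P/eqP => c0; have := core_measure_ge Ei.
rewrite c0 hausdorff_measure0// lee_fin leNgt => /negP; apply.
by rewrite mulr_gt0 ?powR_gt0 ?rad_gt0 ?divr_gt0.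
Qed.

Definition diam_ratio : R := Num.min 1 ((theta / C1 / C2) `^ k^-1).

Lemma diam_ratio_gt0 : 0 < diam_ratio.
Proof. by rewrite lt_min ltr01 powR_gt0// !divr_gt0. Qed.

Lemma diam_ratio_le1 : diam_ratio <= 1.
Proof. by rewrite ge_min lexx. Qed.

(** The part of [E] covered by a piece is too massive for the piece to be
small. This makes the lower mass bound of the piece available at all radii up to
a fixed fraction of the radius of the patch. *)
Lemma piece_diam_ge i : E i.1 ->
  ((diam_ratio * rad i.1 i.2)%:E <= diam (piece i.1 (rad i.1 i.2)))%E.
Proof.
move=> Ei; have [z [_ Gz]] := core_nonempty Ei.
have r0 := rad_gt0 i.1 i.2.
have m0 : 0 < theta / C1 by rewrite divr_gt0.
have mG : ((theta / C1 * rad i.1 i.2 `^ k)%:E <=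
    hausdorff_measure k (piece i.1 (rad i.1 i.2)))%E.
  by apply: le_trans (core_measure_ge Ei) _; apply: le_hausdorff_measure => y [].
apply: le_trans (regular_diam_ge k_gt0 C2_gt1 m0 r0 (piece_reg Ei r0) Gz mG).
by rewrite lee_fin ler_wpM2r ?(ltW r0)// ge_min lexx orbT.
Qed.

Lemma patch_separated i j : chosen i -> chosen j -> i != j ->
  separated (Num.min (rad i.1 i.2) (rad j.1 j.2)) (patch i.1 i.2) (patch j.1 j.2).
Proof.
by apply: separated_selected => [x n|x n _]; [exact: rad_gt0|exact: patch_sub_cball].
Qed.

Lemma large_patch_unique p r i j z w : chosen i -> chosen j ->
  2 * r < rad i.1 i.2 -> 2 * r < rad j.1 j.2 ->
  patch i.1 i.2 z -> mdist p z <= r -> patch j.1 j.2 w -> mdist p w <= r -> i = j.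
Proof.
move=> ci cj ri rj iz pz jw pw; apply/eqP/negPn/negP => ij.
have := patch_separated ci cj ij iz jw; apply/negP; rewrite -ltNge lt_min.
have := metric_triangle z p w; rewrite (metric_sym z p) => zw.
by apply/andP; split; lra.
Qed.

(** The cores are separated subsets of [E], so their total mass is at most that
of [E]: this Carleson packing condition controls the small patches. *)
Lemma chosen_packing e r (s : seq (X * nat)) : E e -> 0 < r -> uniq s ->
  (forall i, i \in s -> chosen i /\ mdist e i.1 + rad i.1 i.2 <= r) ->
  \sum_(i <- s) rad i.1 i.2 `^ k <= C1 ^+ 2 / theta * r `^ k.
Proof.
move=> Ee r0 us sP.
(* A finite family has a smallest radius, hence a common separation. *)
have [eps eps0 epsP] : exists2 eps : R, 0 < eps &
    forall i, i \in s -> eps <= rad i.1 i.2.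
  elim: s {us sP} => [|i s [eps eps0 epsP]]; first by exists 1.
  exists (Num.min eps (rad i.1 i.2)); first by rewrite lt_min eps0 rad_gt0.
  move=> j; rewrite inE => /orP[/eqP ->|js]; first by rewrite ge_min lexx orbT.
  by rewrite ge_min epsP.
have : (\sum_(i <- s) hausdorff_measure k (core i) <=
    hausdorff_measure k (E `&` cball e r))%E.
  apply: (@sum_hausdorff_measure_separated _ _ k eps) => // [i j si sj ij|i si].
    move=> z w iz jw.
    have := patch_separated (sP i si).1 (sP j sj).1 ij
      (core_sub_patch iz) (core_sub_patch jw).
    by apply: le_trans; rewrite le_min !epsP.
  move=> z [[iz Ez] _]; split => //; rewrite /cball/= in iz *.
  by have := metric_triangle e i.1 z; have := (sP i si).2; lra.
move=> /le_trans /(_ (regular_measure_le k_gt0 C1_gt1 Ereg Ee r0)) up.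
have : ((\sum_(i <- s) theta / C1 * rad i.1 i.2 `^ k)%:E <= (C1 * r `^ k)%:E)%E.
  apply: le_trans up; rewrite -sumEFin big_seq [leRHS]big_seq; apply: lee_sum => i si.
  by apply: core_measure_ge; exact: selectedE (sP i si).1.
rewrite lee_fin -mulr_sumr -ler_pdivlMl; last by rewrite divr_gt0.
move=> /le_trans; apply; rewrite le_eqVlt; apply/orP; left; apply/eqP; field.
by rewrite !gt_eqF.
Qed.

(** By packing, only finitely many radii exceed a given [1 / 2 ^+ n]. *)
Lemma countable_chosen e r : E e -> 0 < r ->
  countable [set i | chosen i /\ mdist e i.1 + rad i.1 i.2 <= r].
Proof.
move=> Ee r0; set I := [set i | _].
have -> : I = \bigcup_n [set i | I i /\ 1 / 2 ^+ n <= rad i.1 i.2].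
  apply/seteqP; split => [i Ii|i [n _ []]//].
  by have [n [nr _]] := dyadic_scale ltr01 (rad_gt0 i.1 i.2); exists n.
apply: bigcup_countable => // n _; apply: finite_set_countable.
apply: contrapT => inf.
set v : R := 1 / 2 ^+ n; have v0 : 0 < v `^ k by rewrite powR_gt0// divr_gt0// exprn_gt0.
pose M := C1 ^+ 2 / theta * r `^ k.
have [A AI Asz] := @infinite_set_fset _ _ (Num.bound (M / v `^ k)) inf.
have := chosen_packing Ee r0 (fset_uniq A) (fun i iA => (AI i iA).1).
apply/negP; rewrite -ltNge -/M.
apply: (@lt_le_trans _ _ (\sum_(i <- A) v `^ k)); last first.
  rewrite big_seq [leRHS]big_seq; apply: ler_sum => i iA.
  by apply: (le_powR k_gt0 _ (AI i iA).2); rewrite divr_ge0 ?exprn_ge0.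
rewrite big_const_seq count_predT iter_addr addr0 -mulr_natr mulrC -ltr_pdivrMr//.
have M0 : 0 <= M / v `^ k.
  rewrite /M; apply: divr_ge0; last exact: powR_ge0.
  apply: mulr_ge0; last exact: powR_ge0.
  by apply: divr_ge0; [exact: sqr_ge0|exact: ltW].
apply: lt_le_trans (archi_boundP M0) _.
by rewrite ler_nat.
Qed.

Lemma measure_ball_le C (G : set X) p r : 1 < C -> ahlfors_regular_with k C G ->
  0 < r -> (hausdorff_measure k (G `&` cball p r) <= (C * (2 * r) `^ k)%:E)%E.
Proof.
move=> C_gt1 Greg r0.
have [[q [Gq pq]]|noq] := pselect (G `&` cball p r !=set0); last first.
  rewrite (_ : _ `&` _ = set0) ?hausdorff_measure0//; last first.
      by apply/seteqP; split => // z Gz; apply: noq; exists z.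
  by rewrite lee_fin mulr_ge0 ?powR_ge0//; lra.
have r20 : 0 < 2 * r by rewrite mulr_gt0.
apply: le_trans (regular_measure_le k_gt0 C_gt1 Greg Gq r20).
apply: le_hausdorff_measure => z [Gz pz]; split => //; rewrite /cball/= in pq pz *.
by have := metric_triangle q p z; rewrite (metric_sym q p); lra.
Qed.

Definition upper_const : R :=
  (C1 + C2) * 2 `^ k + C2 * 4 `^ k * (C1 ^+ 2 / theta * 12 `^ k).

(** At most one patch much larger than the ball meets it, while the patches of
radius at most [2 * r] are packed around the ball. *)
Lemma enlargement_measure_le p r : 0 < r ->
  (hausdorff_measure k (enlargement `&` cball p r) <= (upper_const * r `^ k)%:E)%E.
Proof.
move=> r0.
pose meets i := patch i.1 i.2 `&` cball p r !=set0.
pose large := [set i | [/\ chosen i, meets i & 2 * r < rad i.1 i.2]].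
pose small := [set i | [/\ chosen i, meets i & rad i.1 i.2 <= 2 * r]].
have cover : enlargement `&` cball p r `<=` (E `&` cball p r) `|`
    ((\bigcup_(i in large) patch i.1 i.2) `&` cball p r `|`
     \bigcup_(i in small) patch i.1 i.2).
  move=> z [[Ez|[i ci iz]] pz]; first by left.
  have im : meets i by exists z.
  have [ri|ri] := leP (rad i.1 i.2) (2 * r); right; [right|left; split => //].
    by exists i.
  by exists i.
have r20 : 0 < 2 * r by rewrite mulr_gt0.
have largeP : (hausdorff_measure k ((\bigcup_(i in large) patch i.1 i.2) `&` cball p r)
    <= (C2 * (2 * r) `^ k)%:E)%E.
  have [[i [ci [z [iz pz]] ri]]|nolarge] := pselect (large !=set0); last first.
    rewrite (_ : _ `&` _ = set0).
      by rewrite hausdorff_measure0// lee_fin mulr_ge0 ?powR_ge0 ?(ltW C2_gt0).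
    by apply/seteqP; split => // z [[i li _] _]; apply: nolarge; exists i.
  have Ei := selectedE ci.
  apply: le_trans (measure_ball_le p C2_gt1 (piece_reg Ei (rad_gt0 i.1 i.2)) r0).
  apply: le_hausdorff_measure => w [[j [cj _ rj] jw] pw]; split => //.
  rewrite -(large_patch_unique cj ci rj ri jw pw iz pz) in Ei *.
  exact: patch_sub_piece jw.
have smallP : (hausdorff_measure k (\bigcup_(i in small) patch i.1 i.2) <=
    (C2 * 4 `^ k * (C1 ^+ 2 / theta * 12 `^ k) * r `^ k)%:E)%E.
  have K0 : 0 <= C2 * 4 `^ k * (C1 ^+ 2 / theta * 12 `^ k) * r `^ k.
    have Q0 : 0 <= C1 ^+ 2 / theta by rewrite divr_ge0 ?sqr_ge0 ?(ltW theta_gt0).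
    move: (_ / theta) Q0 => Q Q0; by rewrite !mulr_ge0 ?powR_ge0 ?(ltW C2_gt0).
  have [[e se]|nosmall] := pselect (small !=set0); last first.
    rewrite (_ : \bigcup_(i in _) _ = set0) ?hausdorff_measure0 ?lee_fin//.
    by apply/seteqP; split => // z [i si _]; apply: nosmall; exists i.
  have near i : small i -> mdist p i.1 <= 5 * r.
    move=> [ci [z [iz pz]] ri]; have := patch_sub_cball iz.
    rewrite /cball/= in pz *; have := metric_triangle p z i.1.
    by rewrite (metric_sym z); lra.
  have [ce _ _] := se; have Ee := selectedE ce.
  have r12 : 0 < 12 * r by rewrite mulr_gt0.
  have smallI i : small i -> chosen i /\ mdist e.1 i.1 + rad i.1 i.2 <= 12 * r.
    move=> si; have [ci _ ri] := si; split => //.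
    have := metric_triangle e.1 p i.1; have := near i si; have := near e se.
    by rewrite (metric_sym e.1 p); lra.
  apply: hausdorff_measure_bigcup_le => //.
    exact: sub_countable (subset_card_le smallI) (countable_chosen Ee r12).
  move=> s us sI.
  apply: (@le_trans _ _ (\sum_(i <- s) C2 * (4 * rad i.1 i.2) `^ k)%:E).
    rewrite -sumEFin big_seq [leRHS]big_seq; apply: lee_sum => i /sI[ci _ _].
    have Ei := selectedE ci; have ri := rad_gt0 i.1 i.2.
    have -> : 4 * rad i.1 i.2 = 2 * (2 * rad i.1 i.2) by lra.
    have ri2 : 0 < 2 * rad i.1 i.2 by rewrite mulr_gt0.
    apply: le_trans (measure_ball_le i.1 C2_gt1 (piece_reg Ei ri) ri2).
    apply: le_hausdorff_measure => z iz; split; first exact: patch_sub_piece iz.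
    exact: patch_sub_cball.
  rewrite lee_fin.
  under eq_bigr => i _ do rewrite powRM ?(ltW (rad_gt0 _ _))// mulrA.
  rewrite -mulr_sumr -[leRHS]mulrA; apply: ler_wpM2l.
    by rewrite mulr_ge0 ?powR_ge0 ?(ltW C2_gt0).
  rewrite -mulrA -powRM ?(ltW r0)//.
  exact: chosen_packing Ee r12 us (fun i si => smallI i (sI i si)).
apply: (le_trans (le_hausdorff_measure k cover)).
apply: (le_trans (hausdorff_measureU _ _ k_gt0)).
apply: (le_trans (leeD (measure_ball_le p C1_gt1 Ereg r0)
  (le_trans (hausdorff_measureU _ _ k_gt0) (leeD largeP smallP)))).
rewrite -!EFinD lee_fin /upper_const powRM ?(ltW r0)// le_eqVlt; apply/orP; left.
by apply/eqP; ring.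
Qed.

(** Away from [E] the patches have radii bounded below, so that locally only
one of them is present. *)
Lemma closed_enlargement : closed enlargement.
Proof.
move=> p /closure_mdistP pcl; apply: contrapT => npF.
have nEp : ~ E p by move=> Ep; apply: npF; left.
have [d d0 dP] : exists2 d : R, 0 < d & forall e, E e -> d <= mdist p e.
  have [Ecl _ _] := Ereg; apply: contrapT => nod; apply/nEp/Ecl/closure_mdistP => e e0.
  apply: contrapT => noq; apply: nod; exists e => // q Eq; rewrite leNgt.
  by apply/negP => pq; apply: noq; exists q.
have d16 : 0 < d / 16 by rewrite divr_gt0.
have nearby q : enlargement q -> mdist p q < d / 16 ->
    exists i, [/\ chosen i, patch i.1 i.2 q & 2 * (d / 16) < rad i.1 i.2].
  move=> [Eq pq|[i ci iq] pq]; first by have := dP q Eq; lra.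
  exists i; split => //; have := dP _ (selectedE ci); have := patch_sub_cball iq.
  by rewrite /cball/=; have := metric_triangle p q i.1; rewrite (metric_sym q); lra.
have [q Fq pq] := pcl _ d16; have [i [ci iq ri]] := nearby q Fq pq.
apply: npF; right; exists i => //.
apply: (@closed_thicken _ _ (piece i.1 (rad i.1 i.2)) i.1 (rad i.1 i.2)).
apply/closure_mdistP => e e0.
have [w Fw] : exists2 w, enlargement w & mdist p w < Num.min e (d / 16).
  by apply: pcl; rewrite lt_min e0.
rewrite lt_min => /andP[we wd]; have [j [cj jw rj]] := nearby w Fw wd.
exists w => //.
by rewrite (large_patch_unique ci cj ri rj iq (ltW pq) jw (ltW wd)).
Qed.

(** The factor [diam_ratio] brings the surface ball of [thicken_ample] below the
diameter of the piece. *)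
Lemma ample_patch i p s : chosen i -> patch i.1 i.2 p -> 0 < s -> s <= rad i.1 i.2 ->
  ample GG enlargement (diam_ratio / 16) p s.
Proof.
move=> ci ip ss0 sr; have Ei := selectedE ci; have r0 := rad_gt0 i.1 i.2.
have [q [t [Gq st tr pq GT]]] := thicken_ample r0 ss0 sr ip.
have c0 := diam_ratio_gt0; have c1 := diam_ratio_le1.
exists (piece i.1 (rad i.1 i.2)), q, (diam_ratio * t); split; split => //.
- exact: pieceGG.
- apply: le_trans (piece_diam_ge Ei); rewrite lee_fin ler_wpM2l//; exact: ltW.
- by rewrite -mulrA ler_wpM2l ?(ltW c0)//; lra.
- by nra.
- move=> z [Gz qz]; right; exists i => //; apply: GT; split => //.
  by rewrite /cball/= in qz *; apply: (le_trans qz); nra.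
Qed.

(** The nearby patch given by maximality belongs to an earlier or equal stage,
and its centre has a comparable top scale, so its radius is not much smaller. *)
Lemma patch_near x n : E x -> exists i z, [/\ chosen i, patch i.1 i.2 z,
  mdist x z <= 11 * rad x n & rad x n <= 2 * rad i.1 i.2].
Proof.
move=> Ex; have radt y m := rad_le_top y m.
have scale y m : top_scale x <= 2 * top_scale y -> (m <= n)%N ->
    rad x n <= 2 * rad y m.
  move=> xy mn; rewrite /rad mulrA.
  apply: ler_pM => //; rewrite ?invr_ge0 ?exprn_ge0// ?(ltW (top_scale_gt0 x))//.
  by rewrite lef_pV2 ?posrE ?exprn_gt0// ler_weXn2l// ler1n.
have [[i [z [ci lt_in iz xz]]]|[y [cy xy]]] :=
    selected_near patch rad_gt0 n Ex.
  exists i, z; split => //; first by have := rad_gt0 x n; lra.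
  apply: scale; last exact: ltnW.
  have := patch_sub_cball iz; rewrite /cball/= => iz'.
  have := metric_triangle x z i.1; rewrite (metric_sym z).
  have := top_scale_lip x i.1; have := radt x n; have := radt i.1 i.2.
  have := top_scale_gt0 i.1; lra.
have Ey := selectedE cy.
have [z cz] := @core_nonempty (y, n) Ey.
have xyt := top_scale_lip x y; have yxt := top_scale_lip y x.
rewrite (metric_sym y x) in yxt.
have rx := radt x n; have ry := radt y n.
have yx : rad y n <= 2 * rad x n.
  by rewrite /rad mulrA ler_pM2r ?invr_gt0 ?exprn_gt0//; lra.
exists (y, n), z; split => //=.
- exact: (core_sub_patch cz).
- have [[+ _] _] := cz; rewrite /cball/= => yz.
  by have := metric_triangle x y z; lra.
- by apply: scale => //; lra.
Qed.

(** The scales at [x] reach only [top_scale x]. Larger ones occur only when [E] is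
unbounded; a point in an annulus around [x] is then so far from the base point
that its own top scale is comparable to [s]. *)
Lemma remote_center x s : E x -> 0 < s -> (s%:E <= diam E)%E ->
  exists2 x', E x' & mdist x x' <= s / 4 /\
    s / (100 * annulus_ratio k C1) <= top_scale x'.
Proof.
move=> Ex ss0 sE; have A1 := annulus_ratio_ge1 k_gt0 C1_gt1.
set A := annulus_ratio k C1 in A1 *; have A0 : 0 < A by lra.
have [sx|xs] := leP (s / (100 * A)) (top_scale x).
  by exists x => //; split => //; rewrite mdistxx divr_ge0// ltW.
set v := s / (100 * A) in xs *.
have vE : s = 100 * A * v by rewrite /v; field; rewrite gt_eqF.
have v0 : 0 < v by rewrite divr_gt0// mulr_gt0.
have Einf : diam E = +oo%E.
  case: diamE => // Es0; move: sE; rewrite Es0 lee_fin => ss.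
  by exfalso; have := top_scale_ge x; nra.
(* The outer radius of the annulus, [25 * v] times its ratio, is [s / 4]. *)
have t0 : 0 < 25 * v by rewrite mulr_gt0.
have [|y Ey /andP[xy1 xy2]] := regular_annulus k_gt0 C1_gt1 Ereg Ex t0.
  by rewrite Einf leey.
exists y => //; split; first by rewrite -/A in xy2; lra.
have : mdist y x0 / 9 <= top_scale y by rewrite le_max lexx orbT.
have : mdist x x0 / 9 <= top_scale x by rewrite le_max lexx orbT.
have := metric_triangle x x0 y; rewrite (metric_sym x0 y).
lra.
Qed.

Definition ample_const : R := diam_ratio / 16 / (4 * (100 * annulus_ratio k C1)).

(** Half of the ball is spent on reaching a patch, a quarter for the move to
[x'] and a quarter for the [11] radii of [patch_near]; the patch serves the
other half. *)
Lemma ample_original x s : E x -> 0 < s -> (s%:E <= diam E)%E ->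
  ample GG enlargement ample_const x s.
Proof.
move=> Ex ss0 sE; have A1 := annulus_ratio_ge1 k_gt0 C1_gt1.
have [x' Ex' [xx' sx']] := remote_center Ex ss0 sE.
rewrite /ample_const; set A := annulus_ratio k C1 in A1 sx' *.
have A0 : 0 < A by lra.
set v := s / (100 * A) in sx'.
have vE : s = 100 * A * v by rewrite /v; field; rewrite gt_eqF.
have v0 : 0 < v by rewrite divr_gt0// mulr_gt0.
have s44 : 0 < s / 44 by rewrite divr_gt0.
have [n [nle nge]] := dyadic_scale (top_scale_gt0 x') s44.
have [i [z [ci iz x'z ri]]] := patch_near n Ex'.
have {}nge : v <= 2 * rad x' n.
  by apply: le_trans nge; rewrite le_min sx' andbT; nra.
rewrite -/(rad x' n) in nle.
have s'0 : 0 < Num.min (s / 2) (rad i.1 i.2) by rewrite lt_min rad_gt0 divr_gt0.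
have s'r : Num.min (s / 2) (rad i.1 i.2) <= rad i.1 i.2 by rewrite ge_min lexx orbT.
apply: (ample_trans (ample_patch ci iz s'0 s'r)).
  have : Num.min (s / 2) (rad i.1 i.2) <= s / 2 by rewrite ge_min lexx.
  by have := metric_triangle x x' z; lra.
have -> : diam_ratio / 16 / (4 * (100 * A)) * s = diam_ratio / 16 * (v / 4).
  by rewrite vE; field; rewrite gt_eqF.
rewrite ler_wpM2l ?divr_ge0 ?(ltW diam_ratio_gt0)// le_min; apply/andP; split; nra.
Qed.

(** At scales comparable to its radius a patch serves its own points; at larger
ones its centre, which lies in [E], is close enough. The radius [s / 5] reflects
that the enlargement may have up to five times the diameter of [E]. *)
Lemma ample_enlargement p s : enlargement p -> 0 < s -> ((s / 5)%:E <= diam E)%E ->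
  ample GG enlargement (ample_const / 5) p s.
Proof.
move=> Fp ss0 sE; have s5 : 0 < s / 5 by rewrite divr_gt0.
case: Fp => [Ep|[i ci ip]].
  apply: (ample_trans (ample_original Ep s5 sE)); first by rewrite mdistxx; lra.
  by rewrite le_eqVlt; apply/orP; left; apply/eqP; field.
have [sr|rs] := leP s (8 * rad i.1 i.2).
  have s8 : 0 < s / 8 by rewrite divr_gt0.
  have s8r : s / 8 <= rad i.1 i.2 by lra.
  apply: (ample_trans (ample_patch ci ip s8 s8r)); first by rewrite mdistxx; lra.
  have A1 := annulus_ratio_ge1 k_gt0 C1_gt1; have c0 := diam_ratio_gt0.
  rewrite /ample_const; set A := annulus_ratio k C1 in A1 *.
  have -> : diam_ratio / 16 / (4 * (100 * A)) / 5 * s =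
      diam_ratio / 16 * (s / (5 * (4 * (100 * A)))).
    by field; rewrite gt_eqF//; lra.
  rewrite !ler_wpM2l ?divr_ge0 ?(ltW c0) ?(ltW ss0)//.
  by rewrite lef_pV2 ?posrE//; lra.
have Ei := selectedE ci.
apply: (ample_trans (ample_original Ei s5 sE)).
  have := patch_sub_cball ip; rewrite /cball/= metric_sym; lra.
by rewrite le_eqVlt; apply/orP; left; apply/eqP; field.
Qed.

Lemma diam_enlargement s : 0 < s -> (s%:E <= diam enlargement)%E ->
  ((s / 5)%:E <= diam E)%E.
Proof.
move=> ss0 sF; rewrite leNgt; apply/negP => /diam_lt_fin[D ED /andP[D0 Ds]].
have near p : enlargement p -> exists2 e, E e & mdist e p <= 2 * D.
  move=> [Ep|[i ci ip]]; first by exists p => //; rewrite mdistxx; lra.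
  have Ei := selectedE ci; exists i.1 => //.
  have := patch_sub_cball ip; have := rad_le_diam i.2 Ei.
  by rewrite ED lee_fin /cball/=; lra.
move: sF; apply/negP; rewrite -ltNge.
apply: (@le_lt_trans _ _ (5 * D)%:E); last by rewrite lte_fin; lra.
apply: diam_le => [|p q /near[e Ee ep] /near[f Ef fq]]; first by rewrite lee_fin; lra.
have := mdist_le_diam Ee Ef; rewrite ED !lee_fin.
have := metric_triangle p e q; have := metric_triangle e f q.
rewrite (metric_sym p e); lra.
Qed.

End Enlargement.

Theorem theorem3p1 (R : realType) (k theta1 C1 theta2 C2 : R)
    (k_gt0 : 0 < k) (theta1_gt0 : 0 < theta1) (C1_gt1 : 1 < C1)
    (theta2_gt0 : 0 < theta2) (C2_gt1 : 1 < C2) :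
  exists theta' C' : R, [/\ 0 < theta', 1 < C' &
    forall (X : metricType R) (FF : set (set X)) (E : set X),
      (forall G, FF G -> ahlfors_regular k G) ->
      ahlfors_regular k E ->
      big_pieces_with k theta1 C1 (big_pieces_with k theta2 C2 FF) E ->
      exists F : set X,
        [/\ E `<=` F, ahlfors_regular k F & big_pieces k FF F] /\
        (ahlfors_regular_with k C' F /\ big_pieces_with k theta' C' FF F)].
Proof.
pose kappa := ample_const k theta1 C1 C2 / 5.
pose C3 := upper_const k theta1 C1 C2.
have A1 := annulus_ratio_ge1 k_gt0 C1_gt1.
have kappa0 : 0 < kappa.
  by rewrite !divr_gt0 ?mulr_gt0 ?diam_ratio_gt0//; lra.
have C31 : 1 < C3.
  have K1 : 1 <= 2 `^ k.
    by have := @le_powR _ k 1 2 k_gt0 ler01; rewrite powR1; apply; lra.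
  have : 0 <= C2 * 4 `^ k * (C1 ^+ 2 / theta1 * 12 `^ k).
    have Q0 : 0 <= C1 ^+ 2 / theta1 by rewrite divr_ge0 ?sqr_ge0 ?(ltW theta1_gt0).
    have C20 : 0 <= C2 by lra.
    by move: (_ / theta1) Q0 => Q Q0; rewrite !mulr_ge0 ?powR_ge0.
  rewrite /C3 /upper_const; nra.
have K0 : 0 < kappa `^ k by exact: powR_gt0.
exists (theta2 * kappa `^ k / (C2 * C3)), (C3 + C2 / kappa `^ k).
have theta'0 : 0 < theta2 * kappa `^ k / (C2 * C3).
  by rewrite divr_gt0 ?mulr_gt0//; lra.
have C'1 : 1 < C3 + C2 / kappa `^ k.
  have : 0 < C2 / kappa `^ k by rewrite divr_gt0//; lra.
  lra.
split => // X FF E _ _ [Ereg Ebp].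
set GG := big_pieces_with k theta2 C2 FF in Ebp.
have GGreg G : GG G -> ahlfors_regular_with k C2 G by case.
have [piece pieceP] : {piece : X * R -> set X & forall xr, E xr.1 -> 0 < xr.2 ->
    GG (piece xr) /\ (theta1%:E * hausdorff_measure k (cball xr.1 xr.2 `&` E) <=
      hausdorff_measure k (cball xr.1 xr.2 `&` E `&` piece xr))%E}.
  apply: (@choice _ _ (fun xr G => E xr.1 -> 0 < xr.2 -> GG G /\
    (theta1%:E * hausdorff_measure k (cball xr.1 xr.2 `&` E) <=
      hausdorff_measure k (cball xr.1 xr.2 `&` E `&` G))%E)) => -[x r] /=.
  have [[Ex r0]|n] := pselect (E x /\ 0 < r).
    by have [G GGG Gbig] := Ebp x r Ex r0; exists G.
  by exists set0 => Ex r0; exfalso; apply: n.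
have [_ [x0 [y0 [Ex0 Ey0 xy0]]] _] := Ereg.
have E0 := regular_diam_gt0 Ereg.
(* In the unbounded case any positive number can play the role of the diameter. *)
have [s0 [s0_gt0 s0E s0case]] : exists s0 : R, [/\ 0 < s0, (s0%:E <= diam E)%E &
    diam E = s0%:E \/ diam E = +oo%E].
  have [Einf|Efin] := eqVneq (diam E) +oo%E.
    by exists 1; split => //; [rewrite Einf leey|right].
  have {}Efin : diam E \is a fin_num by rewrite ge0_fin_numE ?ltey// diam_ge0.
  exists (fine (diam E)); rewrite fineK//; split => //; last by left.
  by rewrite -lte_fin fineK.
pose piece' x r := piece (x, r).
have pieceGG x r : E x -> 0 < r -> GG (piece' x r).
  by move=> Ex r0; have [] := pieceP (x, r) Ex r0.
have piece_big x r : E x -> 0 < r ->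
    (theta1%:E * hausdorff_measure k (cball x r `&` E) <=
      hausdorff_measure k (cball x r `&` E `&` piece' x r))%E.
  by move=> Ex r0; have [] := pieceP (x, r) Ex r0.
pose F := enlargement E piece' x0 s0.
have EF : E `<=` F by move=> x Ex; left.
have [Freg Fbp] : ahlfors_regular_with k (C3 + C2 / kappa `^ k) F /\
    big_pieces_with k (theta2 * kappa `^ k / (C2 * C3)) (C3 + C2 / kappa `^ k) FF F.
  apply: (@ample_big_pieces _ _ GG) => //.
  - apply: closed_enlargement; eassumption.
  - by exists x0, y0; split => //; exact: EF.
  - move=> p r r0; apply: enlargement_measure_le; eassumption.
  - move=> p s Fp ss0 sF; apply: ample_enlargement; try eassumption.
    exact: (diam_enlargement Ex0 s0_gt0 s0E ss0 sF).
exists F; split => //; split => //.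
  by exists (C3 + C2 / kappa `^ k).
by exists (theta2 * kappa `^ k / (C2 * C3)), (C3 + C2 / kappa `^ k).
Qed.
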